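(* Assume that there exist constants $L\ge 0$ and $B\ge 0$ such that $$B^2+L(F(x)-F^* )\ \ge\ \frac1N\sum_{i=1}^N\|\nabla F_i(x)\|^2\qquad\forall x\in\mathcal{Y},$$ and let the random vector $\zeta\in\mathbb{R}^N$ satisfy $\mathbb{E}[\zeta^i]=1$ for all $i=1:N$. Then the (sub)gradients of $F(\cdot,\zeta)$ satisfy $$\mathcal{B}^2+\mathcal{L}\,(F(x)-F^* )\ \ge\ \mathbb{E}_\zeta\big[\|\nabla F(x,\zeta)\|^2\big]\qquad\forall x\in\mathcal{Y},$$ with $\mathcal{B}^2=\frac{\mathbb{E}[\|\zeta\|^2]}{N}B^2$ and $\mathcal{L}=\frac{\mathbb{E}[\|\zeta\|^2]}{N}L$.
   Context: $\mathcal{Y}\subseteq\mathbb{R}^n$ is a nonempty closed convex set; $f_i,g_i$ ($i=1:N$, i.e. $i\in\{1,\dots,N\}$) and $h_j$ ($j=1:m$) are proper lower semicontinuous convex functions on $\mathbb{R}^n$ whose effective domains contain the interior of $\mathcal{Y}$, and all the $g_i$ have a common domain. Put $F_i=f_i+g_i$, $F=\frac1N\sum_{i=1}^N F_i$, $\mathcal{X}=\{x\in\mathcal{Y}: h_j(x)\le 0\ \forall j=1:m\}$ and $F^*=\min_{x\in\mathcal{X}}F(x)$, where $F^*>-\infty$ is assumed and the set of minimizers $\mathcal{X}^*$ is assumed nonempty. $\nabla f_i(x)$, $\nabla g_i(x)$ denote (sub)gradients, i.e. elements of $\partial f_i(x)$, $\partial g_i(x)$, and $\nabla F_i(x)=\nabla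 f_i(x)+\nabla g_i(x)$. The random vector $\zeta$ has components $\zeta^1,\dots,\zeta^N$ and is drawn from a probability distribution on a finite probability space. Define $F(x,\zeta)=\frac1N\sum_{i=1}^N\zeta^i F_i(x)$ and $\nabla F(x,\zeta)=\frac1N\sum_{i=1}^N\zeta^i\nabla F_i(x)$. $\|\cdot\|$ is the Euclidean norm. *)

(* Defs.v *)
From HB Require Import structures.
From mathcomp Require Import all_boot all_order all_algebra.
From mathcomp Require Import all_classical all_reals all_analysis.
Set Implicit Arguments.
Unset Strict Implicit.
Unset Printing Implicit Defensive.
Import Order.TTheory GRing.Theory Num.Theory.
Import numFieldNormedType.Exports.
Local Open Scope classical_set_scope.
Local Open Scope ring_scope.

Section Euclidean.
Context {R : realType} {n : nat}.
Implicit Types u v : 'rV[R]_n.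

Definition edot u v : R := \sum_(k < n) u ord0 k * v ord0 k.

(* The library's norm on 'rV[R]_n is the sup norm. It induces the same
   topology, so [closed] and [interior] can be used as they are. *)
Definition enorm u : R := Num.sqrt (edot u u).

End Euclidean.

Section ConvexAnalysis.
Context {R : realType} {n : nat}.
Implicit Types (phi : 'rV[R]_n -> \bar R) (x : 'rV[R]_n).
Local Open Scope ereal_scope.

Definition edom phi : set 'rV[R]_n := [set x | phi x < +oo].

Definition proper phi : Prop := (forall x, -oo < phi x) /\ edom phi !=set0.

(* Meant for functions that never take the value -oo: the right-hand side is
   then never of the form oo - oo, and 0 * +oo = 0 makes t = 0 and t = 1
   harmless. *)
Definition convex_efun phi : Prop :=
  forall x y (t : R), (0 <= t <= 1)%R ->
    phi (t *: x + (1 - t) *: y)%R <= t%:E * phi x + (1 - t)%:E * phi y.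

Definition proper_lsc_convex phi : Prop :=
  [/\ proper phi, lower_semicontinuous phi & convex_efun phi].

(* Empty at every x outside the effective domain of a proper phi. *)
Definition subdifferential phi x : set 'rV[R]_n :=
  [set v | forall y, phi x + (edot v (y - x)%R)%:E <= phi y].

End ConvexAnalysis.

Section Problem.
Context {R : realType} {n N m : nat}.
Local Notation E := 'rV[R]_n.
Local Open Scope ereal_scope.

Definition comp_fun (f g : 'I_N -> E -> \bar R) (i : 'I_N) (x : E) : \bar R :=
  f i x + g i x.

Definition obj (f g : 'I_N -> E -> \bar R) (x : E) : \bar R :=
  (N%:R^-1)%:E * \sum_(i < N) comp_fun f g i x.

Definition feasible (Y : set E) (h : 'I_m -> E -> \bar R) : set E :=
  [set x | Y x /\ forall j, h j x <= 0].

Definition opt_val (F : E -> \bar R) (X : set E) : \bar R :=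
  ereal_inf [set F x | x in X].

Definition minimizers (F : E -> \bar R) (X : set E) : set E :=
  [set x | X x /\ F x = opt_val F X].

(* df i x and dg i x stand for the (sub)gradients written \nabla f_i(x) and
   \nabla g_i(x). A function into E has a value at every x, so it has to be
   said where these values are subgradients: a subdifferential can be empty at
   a boundary point of Y. *)
Definition subgradients_at (f g : 'I_N -> E -> \bar R) (df dg : 'I_N -> E -> E)
    (x : E) : Prop :=
  forall i, subdifferential (f i) x (df i x) /\
            subdifferential (g i) x (dg i x).

Local Close Scope ereal_scope.

Definition comp_grad (df dg : 'I_N -> E -> E) (i : 'I_N) (x : E) : E :=
  df i x + dg i x.

Definition stoch_grad (df dg : 'I_N -> E -> E) (z : 'rV[R]_N) (x : E) : E :=
  N%:R^-1 *: \sum_(i < N) z ord0 i *: comp_grad df dg i x.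

End Problem.

Definition rvec {d} {Omega : measurableType d} {R : realType}
    {P : probability Omega R} {N : nat} (zeta : 'I_N -> {RV P >-> R})
    (w : Omega) : 'rV[R]_N :=
  \row_(i < N) zeta i w.

(* Main.v *)
Require Import Defs.
From HB Require Import structures.
From mathcomp Require Import all_boot all_order all_algebra.
From mathcomp Require Import all_classical all_reals all_analysis.
From mathcomp Require Import measurable_realfun ring.
Set Implicit Arguments.
Unset Strict Implicit.
Unset Printing Implicit Defensive.
Import Order.TTheory GRing.Theory Num.Theory.
Import numFieldNormedType.Exports.
Local Open Scope classical_set_scope.
Local Open Scope ring_scope.

(** For a fixed outcome, Cauchy-Schwarz gives
      || 1/N sum_i zeta^i a_i ||^2 <= (||zeta||^2 / N) * (1/N sum_i ||a_i||^2)
    with [a_i] the gradient of [F_i] at [x] ([enorm_stoch_grad_sqr_le]). The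
    second factor does not depend on the outcome, so taking expectations
    multiplies it by c = E[||zeta||^2] / N, and the assumed bound on the second
    factor is then scaled by c.

    The scaling takes place in the extended reals, where [F x - Fstar] may be
    infinite, and distributing c over a sum is legitimate there because c is
    finite: on a finite probability space every random variable is bounded
    ([finite_Lfun1]). *)

Section EuclideanNorm.
Context {R : realType} {n : nat}.
Implicit Types u v : 'rV[R]_n.

Lemma edot_ge0 u : 0 <= edot u u.
Proof. by apply: sumr_ge0 => k _; rewrite -expr2 sqr_ge0. Qed.

Lemma enorm_sqr u : enorm u ^+ 2 = edot u u.
Proof. by rewrite sqr_sqrtr ?edot_ge0. Qed.

Lemma enormZ_sqr (a : R) u : enorm (a *: u) ^+ 2 = a ^+ 2 * enorm u ^+ 2.
Proof.
rewrite !enorm_sqr mulr_sumr; apply: eq_bigr => k _.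
by rewrite !mxE mulrACA.
Qed.

(** Cauchy-Schwarz, from Lagrange's identity: twice the difference of the two
    sides is the sum of the squares (u_i v_j - u_j v_i)^2 over all i, j. *)
Lemma edot_sqr_le u v : edot u v ^+ 2 <= edot u u * edot v v.
Proof.
have sumM (a b : 'I_n -> R) :
    \sum_i \sum_j a i * b j = (\sum_i a i) * (\sum_j b j).
  by rewrite mulr_suml; apply: eq_bigr => i _; rewrite mulr_sumr.
have lagrange : \sum_i \sum_j (u ord0 i * v ord0 j - u ord0 j * v ord0 i) ^+ 2
    = (edot u u * edot v v - edot u v ^+ 2) *+ 2.
  have sqrE i j : (u ord0 i * v ord0 j - u ord0 j * v ord0 i) ^+ 2
      = (u ord0 i * u ord0 i) * (v ord0 j * v ord0 j)
        + (v ord0 i * v ord0 i) * (u ord0 j * u ord0 j)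
        + (- 2 * (u ord0 i * v ord0 i)) * (u ord0 j * v ord0 j) by ring.
  under eq_bigr => i _ do under eq_bigr => j _ do rewrite sqrE.
  under eq_bigr => i _ do rewrite !big_split /=.
  by rewrite !big_split /= !sumM -mulr_sumr /edot; ring.
rewrite -subr_ge0 -(pmulrn_lge0 _ (isT : (0 < 2)%N)) -lagrange.
by apply: sumr_ge0 => i _; apply: sumr_ge0 => j _; exact: sqr_ge0.
Qed.

End EuclideanNorm.

Section LinearCombinations.
Context {R : realType} {n N : nat}.

(** Cauchy-Schwarz in each coordinate of the combination. *)
Lemma enorm_lincomb_sqr_le (z : 'rV[R]_N) (a : 'I_N -> 'rV[R]_n) :
  enorm (\sum_i z ord0 i *: a i) ^+ 2
    <= enorm z ^+ 2 * \sum_i enorm (a i) ^+ 2.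
Proof.
under [in leRHS]eq_bigr => i _ do rewrite enorm_sqr.
rewrite !enorm_sqr [in leRHS]exchange_big /= mulr_sumr.
apply: ler_sum => k _; rewrite -expr2.
suff -> : (\sum_i z ord0 i *: a i) ord0 k = edot z (\row_i a i ord0 k).
  apply: (le_trans (edot_sqr_le _ _)).
  by under [X in _ * X]eq_bigr => i _ do rewrite !mxE.
by rewrite summxE; apply: eq_bigr => i _; rewrite !mxE.
Qed.

Lemma enorm_stoch_grad_sqr_le (df dg : 'I_N -> 'rV[R]_n -> 'rV[R]_n)
    (z : 'rV[R]_N) (x : 'rV[R]_n) :
  enorm (stoch_grad df dg z x) ^+ 2
    <= (N%:R^-1 * (N%:R^-1 * \sum_i enorm (comp_grad df dg i x) ^+ 2))
       * enorm z ^+ 2.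
Proof.
rewrite enormZ_sqr [leRHS](_ : _ = N%:R^-1 ^+ 2 *
  (enorm z ^+ 2 * \sum_i enorm (comp_grad df dg i x) ^+ 2)); last by ring.
by rewrite ler_wpM2l ?sqr_ge0// enorm_lincomb_sqr_le.
Qed.

End LinearCombinations.

Section RandomVectors.
Context {d : measure_display} {Omega : measurableType d} {R : realType}.

Lemma measurable_enorm_sqr {n : nat} (u : Omega -> 'rV[R]_n) :
  (forall k, measurable_fun setT (fun w => u w ord0 k)) ->
  measurable_fun setT (fun w => enorm (u w) ^+ 2).
Proof.
move=> mu; under eq_fun do rewrite enorm_sqr.
by apply: measurable_sum => k; exact: measurable_funM.
Qed.

Context (P : probability Omega R).

Lemma finite_Lfun1 (X : Omega -> R) :
  finite_set [set: Omega] -> measurable_fun setT X -> X \in Lfun P 1.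
Proof.
move=> /finite_seqP[s sT] mX; apply/Lfun1_integrable.
apply: measurable_bounded_integrable => //.
  exact: le_lt_trans (probability_le1 P measurableT) (ltry 1).
exists (\sum_(w <- s) `|X w|); split; first exact: num_real.
move=> M ltM w _; apply: le_trans (ltW ltM).
have ws : w \in s by move: (I : [set: Omega] w); rewrite sT.
by rewrite (big_rem w ws)/= lerDl sumr_ge0.
Qed.

Lemma measurable_rvec_enorm_sqr {N : nat} (zeta : 'I_N -> {RV P >-> R}) :
  measurable_fun setT (fun w => enorm (rvec zeta w) ^+ 2).
Proof.
by apply: measurable_enorm_sqr => i; under eq_fun do rewrite mxE; exact: measurable_funPT.
Qed.

Lemma measurable_stoch_grad_enorm_sqr {n N : nat}
    (df dg : 'I_N -> 'rV[R]_n -> 'rV[R]_n) (zeta : 'I_N -> {RV P >-> R})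
    (x : 'rV[R]_n) :
  measurable_fun setT
    (fun w => enorm (stoch_grad df dg (rvec zeta w) x) ^+ 2).
Proof.
apply: measurable_enorm_sqr => k.
under eq_fun do rewrite mxE summxE.
apply: measurable_funM => //; apply: measurable_sum => i.
by under eq_fun do rewrite !mxE; exact: measurable_funM.
Qed.

End RandomVectors.

Theorem lemma3p2 (R : realType) (n N m : nat) (N_gt0 : (0 < N)%N)
  (Y : set 'rV[R]_n)
  (f g : 'I_N -> 'rV[R]_n -> \bar R) (h : 'I_m -> 'rV[R]_n -> \bar R)
  (Y_nonempty : Y !=set0) (Y_closed : closed Y) (Y_convex : @convex_set R _ Y)
  (f_plc : forall i, proper_lsc_convex (f i))
  (g_plc : forall i, proper_lsc_convex (g i))
  (h_plc : forall j, proper_lsc_convex (h j))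
  (f_dom : forall i, interior Y `<=` edom (f i))
  (g_dom : forall i, interior Y `<=` edom (g i))
  (h_dom : forall j, interior Y `<=` edom (h j))
  (g_common_dom : forall i i', edom (g i) = edom (g i'))
  (F := obj f g) (X := feasible Y h) (Fstar := opt_val F X)
  (Fstar_gt : (-oo < Fstar)%E)
  (minimizers_nonempty : minimizers F X !=set0)
  (df dg : 'I_N -> 'rV[R]_n -> 'rV[R]_n)
  (L B : R) (L_ge0 : 0 <= L) (B_ge0 : 0 <= B)
  (bounded_grad : forall x, Y x -> subgradients_at f g df dg x ->
    ((B ^+ 2)%:E + L%:E * (F x - Fstar) >=
     (N%:R^-1 * \sum_(i < N) enorm (comp_grad df dg i x) ^+ 2)%:E)%E)
  (d : measure_display) (Omega : measurableType d) (P : probability Omega R)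
  (Omega_finite : finite_set [set: Omega])
  (zeta : 'I_N -> {RV P >-> R})
  (zeta_mean : forall i, ('E_P[zeta i] = 1)%E)
  (Ezeta2 := 'E_P[fun w => (enorm (rvec zeta w) ^+ 2)%R]%E)
  (calB2 := (Ezeta2 * (N%:R^-1)%:E * (B ^+ 2)%:E)%E)
  (calL := (Ezeta2 * (N%:R^-1)%:E * L%:E)%E) :
  forall x, Y x -> subgradients_at f g df dg x ->
    (calB2 + calL * (F x - Fstar) >=
     'E_P[fun w => (enorm (stoch_grad df dg (rvec zeta w) x) ^+ 2)%R])%E.
Proof.
move=> x Yx subx.
have Ezeta2_Lfun : (fun w => enorm (rvec zeta w) ^+ 2) \in Lfun P 1.
  by apply: finite_Lfun1 => //; exact: measurable_rvec_enorm_sqr.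
have Ezeta2_fin : Ezeta2 \is a fin_num by exact: expectation_fin_num.
have Ezeta2_ge0 : (0 <= Ezeta2)%E.
  by apply: expectation_ge0 => w; exact: sqr_ge0.
set S := N%:R^-1 * \sum_(i < N) enorm (comp_grad df dg i x) ^+ 2.
have S_ge0 : 0 <= S.
  by rewrite mulr_ge0 ?invr_ge0// sumr_ge0// => i _; exact: sqr_ge0.
have c_ge0 : (0 <= Ezeta2 * (N%:R^-1)%:E)%E.
  by rewrite mule_ge0// lee_fin invr_ge0.
have -> : (calB2 + calL * (F x - Fstar) = Ezeta2 * (N%:R^-1)%:E *
    ((B ^+ 2)%:E + L%:E * (F x - Fstar)))%E.
  by rewrite [RHS]muleDr ?fin_numM ?fin_num_adde_defr// [in RHS]muleA.
apply: le_trans (lee_wpmul2l c_ge0 (bounded_grad x Yx subx)).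
have -> : (Ezeta2 * (N%:R^-1)%:E * S%:E = (N%:R^-1 * S)%:E * Ezeta2)%E.
  by rewrite -muleA -EFinM muleC.
rewrite -expectationZl//; apply: expectation_le.
- exact: measurable_stoch_grad_enorm_sqr.
- by apply: measurable_funM => //; exact: measurable_rvec_enorm_sqr.
- by move=> w; exact: sqr_ge0.
- by move=> w /=; rewrite mulr_ge0 ?sqr_ge0// mulr_ge0 ?invr_ge0.
- by apply: aeW => w /=; rewrite [leRHS]mulrC;
  exact: enorm_stoch_grad_sqr_le.
Qed.
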